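(* Let $q\in\mathbb{C}$ and let $(\mathcal{B}(q),[\cdot,\cdot])$ be the Block Lie algebra. If $q\notin\mathbb{Z}$, then all the transposed Poisson algebra structures on $(\mathcal{B}(q),[\cdot,\cdot])$ are trivial. If $q\in\mathbb{Z}$, then, up to an isomorphism, there is only one non-trivial transposed Poisson algebra structure $\cdot$ on $(\mathcal{B}(q),[\cdot,\cdot])$, given by $$L_{0,-2q}\cdot L_{0,-2q}=L_{0,-q},$$ where all other products of basis elements $L_{m,i}\cdot L_{n,j}$, $(m,i,n,j)\ne(0,-2q,0,-2q)$, are zero.
   Context: All algebras are over $\mathbb{C}$ and all linear maps are $\mathbb{C}$-linear. For $q\in\mathbb{C}$, the Block Lie algebra $\mathcal{B}(q)$ is the complex Lie algebra with basis $\{L_{m,i}\mid m,i\in\mathbb{Z}\}$ and bracket $[L_{m,i},L_{n,j}]=(n(i+q)-m(j+q))L_{m+n,i+j}$ for all $i,j,m,n\in\mathbb{Z}$. A transposed Poisson algebra structure on a Lie algebra $(\mathfrak{L},[\cdot,\cdot])$ is a commutative associative bilinear multiplication $\cdot$ on $\mathfrak{L}$ such that $2z\cdot[x,y]=[z\cdot x,y]+[x,z\cdot y]$ for all $x,y,z\in\mathfrak{L}$. It is called trivial if $x\cdot y=0$ for all $x,y$. Two transposed Poisson structures $\cdot$ and $*$ on $(\mathfrak{L},[\cdot,\cdot])$ are isomorphic if there is an automorphism $\phi$ of the Lie algebra $(\mathfrak{L},[\cdot,\cdot])$ with $\phi(x\cdot y)=\phi(x)*\phi(y)$ for all $x,y\in\mathfrak{L}$.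 *)

(* Defs.v *)
From HB Require Import structures.
From mathcomp Require Import all_boot all_order all_algebra.
From mathcomp Require Import finmap.
From mathcomp Require Export monalg.
From mathcomp Require Import ring.

Set Implicit Arguments.
Unset Strict Implicit.
Unset Printing Implicit Defensive.

Import GRing.Theory Num.Theory.
Local Open Scope ring_scope.

Definition is_bilinear (F : fieldType) (V : lmodType F) (f : V -> V -> V) :=
  (forall x, linear (f x)) /\ (forall y, linear (f^~ y)).

Record lieAlgebra (F : fieldType) := LieAlgebra {
  lie_car :> lmodType F;
  bracket : lie_car -> lie_car -> lie_car;
  bracket_bilinear : is_bilinear bracket;
  bracket_alternating : forall x, bracket x x = 0;
  bracket_jacobi : forall x y z,
    bracket x (bracket y z) + bracket y (bracket z x)
      + bracket z (bracket x y) = 0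
}.

Record transposedPoisson (F : fieldType) (L : lieAlgebra F) :=
  TransposedPoisson {
  tp_mul :> L -> L -> L;
  tp_bilinear : is_bilinear tp_mul;
  tp_mulC : commutative tp_mul;
  tp_mulA : associative tp_mul;
  tp_leibniz : forall x y z,
    2%:R *: tp_mul z (bracket x y)
      = bracket (tp_mul z x) y + bracket x (tp_mul z y)
}.

Definition tp_trivial (F : fieldType) (L : lieAlgebra F)
    (P : transposedPoisson L) := forall x y : L, P x y = 0.

Definition lie_automorphism (F : fieldType) (L : lieAlgebra F) (phi : L -> L) :=
  [/\ linear phi, bijective phi
    & forall x y, phi (bracket x y) = bracket (phi x) (phi y)].

Definition tp_isomorphic (F : fieldType) (L : lieAlgebra F)
    (P P' : transposedPoisson L) :=
  exists2 phi : L -> L, lie_automorphism phi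
    & forall x y, phi (P x y) = P' (phi x) (phi y).

Section BilinearExtension.
Context (F : fieldType) (K : choiceType).
Implicit Types (b : K -> K -> {malg F[K]}) (x y : {malg F[K]}).

(* The bilinear map on the vector space with basis K that takes the value
   [b u v] on the pair (<< u >>, << v >>) of basis vectors. *)
Definition bilinear_ext b x y : {malg F[K]} :=
  \sum_(u <- msupp x) \sum_(v <- msupp y) (x@_u * y@_v) *: b u v.

Lemma bilinear_extw b x y (dx dy : {fset K}) :
  (msupp x `<=` dx)%fset -> (msupp y `<=` dy)%fset ->
  bilinear_ext b x y = \sum_(u <- dx) \sum_(v <- dy) (x@_u * y@_v) *: b u v.
Proof.
move=> sx sy; rewrite /bilinear_ext (big_fset_incl _ sx) /=.
  apply: eq_bigr => u _; apply: big_fset_incl => // v _ /mcoeff_outdom ->.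
  by rewrite mulr0 scale0r.
move=> u _ /mcoeff_outdom xu.
by rewrite big1 // => v _; rewrite xu mul0r scale0r.
Qed.

Lemma bilinear_extUU b u v : bilinear_ext b << u >> << v >> = b u v.
Proof.
rewrite (bilinear_extw b (dx := [fset u]%fset) (dy := [fset v]%fset))
  ?msuppU_le //.
by rewrite !big_seq_fset1 !mcoeffUU mulr1 scale1r.
Qed.

Lemma bilinear_extP b : is_bilinear (bilinear_ext b).
Proof.
split=> [x a y z|y a x z].
- pose d := (msupp (a *: y + z) `|` (msupp y `|` msupp z))%fset.
  have sx := fsubset_refl (msupp x).
  rewrite !(@bilinear_extw b x _ (msupp x) d) //; first last.
  + by rewrite /d fsubsetUl.
  + by rewrite /d fsubsetU // fsubsetUl orbT.
  + by rewrite /d fsubsetU // fsubsetUr orbT.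
  rewrite scaler_sumr -big_split; apply: eq_bigr => u _ /=.
  rewrite scaler_sumr -big_split; apply: eq_bigr => v _ /=.
  by rewrite mcoeffD mcoeffZ scalerA -scalerDl; congr (_ *: _); ring.
- pose d := (msupp (a *: x + z) `|` (msupp x `|` msupp z))%fset.
  have sy := fsubset_refl (msupp y).
  rewrite !(@bilinear_extw b _ y d (msupp y)) //; first last.
  + by rewrite /d fsubsetUl.
  + by rewrite /d fsubsetU // fsubsetUl orbT.
  + by rewrite /d fsubsetU // fsubsetUr orbT.
  rewrite scaler_sumr -big_split; apply: eq_bigr => u _ /=.
  rewrite scaler_sumr -big_split; apply: eq_bigr => v _ /=.
  by rewrite mcoeffD mcoeffZ scalerA -scalerDl; congr (_ *: _); ring.
Qed.

Lemma malg_linear_eq0 (f : {malg F[K]} -> {malg F[K]}) :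
  linear f -> (forall u, f << u >> = 0) -> forall x, f x = 0.
Proof.
move=> lf f0 x.
have fD : {morph f : y z / y + z}.
  by move=> y z; rewrite -[y]scale1r lf !scale1r.
have fz : f 0 = 0.
  by have /eqP := fD 0 0; rewrite addr0 -subr_eq0 opprD addrA subrr sub0r
    oppr_eq0 => /eqP.
have fZ a y : f (a *: y) = a *: f y by rewrite -[a *: y]addr0 lf fz addr0.
rewrite [x]monalgE (big_morph f fD fz) big1 // => u _.
have -> : << x@_u *g u >> = x@_u *: << u >> :> {malg F[K]}.
  by apply/malgP => v; rewrite mcoeffZ !mcoeffU mulrnAr mulr1.
by rewrite fZ f0 scaler0.
Qed.

Lemma bilinear_ext_alt b : (forall u, b u u = 0) ->
  (forall u v, b u v = - b v u) -> forall x, bilinear_ext b x x = 0.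
Proof.
move=> b0 bN x; have [bl br] := bilinear_extP b.
have fDl y : {morph bilinear_ext b y : s t / s + t}.
  by move=> s t; rewrite -[s]scale1r bl !scale1r.
have fDr y : {morph (bilinear_ext b)^~ y : s t / s + t}.
  by move=> s t; rewrite -[s]scale1r br !scale1r.
have fl0 y : bilinear_ext b y 0 = 0.
  by have := bl y (-1) 0 0; rewrite scaler0 addr0 scaleN1r addNr.
have fr0 y : bilinear_ext b 0 y = 0.
  by have := br y (-1) 0 0; rewrite scaler0 addr0 scaleN1r addNr.
have fZl y a s : bilinear_ext b y (a *: s) = a *: bilinear_ext b y s.
  by rewrite -[a *: s]addr0 bl fl0 addr0.
have fZr y a s : bilinear_ext b (a *: s) y = a *: bilinear_ext b s y.
  by rewrite -[a *: s]addr0 br fr0 addr0.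
have UE c u : << c *g u >> = c *: << u >> :> {malg F[K]}.
  by apply/malgP => v; rewrite mcoeffZ !mcoeffU mulrnAr mulr1.
have skewb y z : bilinear_ext b y z + bilinear_ext b z y = 0.
  move: z; apply: malg_linear_eq0.
    by move=> a s t; rewrite bl br scalerDr addrACA.
  move=> v; move: y; apply: malg_linear_eq0.
    by move=> a s t; rewrite bl br scalerDr addrACA.
  by move=> u; rewrite !bilinear_extUU bN addNr.
rewrite [x]monalgE; elim: (enum_fset (msupp x)) => [|u s IH].
  by rewrite big_nil fl0.
rewrite big_cons fDl !fDr IH addr0 -addrA skewb addr0 UE fZl fZr.
by rewrite bilinear_extUU b0 !scaler0.
Qed.

Lemma bilinear_jacobi (f : {malg F[K]} -> {malg F[K]} -> {malg F[K]}) :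
    is_bilinear f ->
    (forall u v w, f << u >> (f << v >> << w >>) + f << v >> (f << w >> << u >>)
      + f << w >> (f << u >> << v >>) = 0) ->
  forall x y z, f x (f y z) + f y (f z x) + f z (f x y) = 0.
Proof.
move=> [l r] f0 x y z.
have fl a s t p : f p (a *: s + t) = a *: f p s + f p t by exact: l.
have fr a s t p : f (a *: s + t) p = a *: f s p + f t p by exact: r.
move: z; apply: malg_linear_eq0 => [a s t|w].
  by rewrite !(fl, fr); apply/malgP => k; rewrite !(mcoeffD, mcoeffZ); ring.
move: y; apply: malg_linear_eq0 => [a s t|v].
  by rewrite !(fl, fr); apply/malgP => k; rewrite !(mcoeffD, mcoeffZ); ring.
move: x; apply: malg_linear_eq0 => [a s t|u] //.
by rewrite !(fl, fr); apply/malgP => k; rewrite !(mcoeffD, mcoeffZ); ring.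
Qed.

End BilinearExtension.

Section Block.
Context (F : fieldType) (q : F).

Definition block_coef (u v : int * int) : F :=
  v.1%:~R * (u.2%:~R + q) - u.1%:~R * (v.2%:~R + q).

Definition block_basis_bracket (u v : int * int) :
    {malg F[(int * int)%type]} :=
  block_coef u v *: << (u.1 + v.1, u.2 + v.2) >>.

Definition block_bracket := bilinear_ext block_basis_bracket.

Lemma block_bracket_bilinear : is_bilinear block_bracket.
Proof. exact: bilinear_extP. Qed.

Lemma block_bracket_alternating x : block_bracket x x = 0.
Proof.
apply: bilinear_ext_alt => [u|u v]; rewrite /block_basis_bracket.
  by rewrite /block_coef subrr scale0r.
by rewrite -scaleNr /block_coef opprB [u.1 + _]addrC [u.2 + _]addrC.
Qed.

Lemma block_bracket_jacobi x y z :
  block_bracket x (block_bracket y z) + block_bracket y (block_bracket z x)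
    + block_bracket z (block_bracket x y) = 0.
Proof.
have [bl _] := block_bracket_bilinear.
apply: (bilinear_jacobi block_bracket_bilinear) => u v w {x y z}.
have nested (a b c : int * int) :
    block_bracket << a >> (block_bracket << b >> << c >>) =
    (block_coef b c * block_coef a (b.1 + c.1, b.2 + c.2)) *:
      << (a.1 + b.1 + c.1, a.2 + b.2 + c.2) >>.
  have b0 : block_bracket << a >> 0 = 0.
    by have := bl << a >> (-1) 0 0; rewrite scaler0 addr0 scaleN1r addNr.
  have -> : block_bracket << b >> << c >> = block_basis_bracket b c + 0.
    by rewrite addr0; exact: bilinear_extUU.
  rewrite [LHS]bl b0 addr0 /block_bracket bilinear_extUU.
  by rewrite /block_basis_bracket scalerA !addrA.
rewrite !nested.
have -> : v.1 + w.1 + u.1 = u.1 + v.1 + w.1 by ring.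
have -> : v.2 + w.2 + u.2 = u.2 + v.2 + w.2 by ring.
have -> : w.1 + u.1 + v.1 = u.1 + v.1 + w.1 by ring.
have -> : w.2 + u.2 + v.2 = u.2 + v.2 + w.2 by ring.
rewrite -!scalerDl /block_coef /= !rmorphD /=.
by rewrite [X in X *: _](_ : _ = 0) ?scale0r //; ring.
Qed.

Definition block : lieAlgebra F :=
  LieAlgebra block_bracket_bilinear block_bracket_alternating
    block_bracket_jacobi.

Definition blockL (m i : int) : block := << (m, i) >>.

Lemma block_bracketE (m i n j : int) :
  bracket (blockL m i) (blockL n j)
    = (n%:~R * (i%:~R + q) - m%:~R * (j%:~R + q)) *: blockL (m + n) (i + j).
Proof. exact: bilinear_extUU. Qed.

End Block.

(* Main.v *)
(* For z fixed, left multiplication by z in a transposed Poisson structure is a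
   1/2-derivation of B(q); the bracket being graded by Z^2, so is each of its
   homogeneous components L_{m,i} |-> f(m,i) L_{m+a,i+b}. Comparing the action
   of L_{0,I} twice with that of L_{0,2I} on the resulting functional equation
   gives f = 0 if a <> 0, while for a = 0 the function f is a constant gamma,
   with gamma = 0 unless b = 0, except possibly at L_{0,-2q} when b = q. That
   exception exists because L_{0,-2q} is not in the derived algebra and
   L_{0,-q} is central. Commutativity kills gamma, so the product is supported
   on L_{0,-2q}.L_{0,-2q} = c L_{0,-q}. A diagonal automorphism normalizes c:
   L_{m,i} |-> t^i L_{m,i} with t^(-3q) = c when q <> 0, and rescaling L_{0,0}
   when q = 0. *)

Require Import Defs.
From mathcomp Require Import all_boot all_order all_algebra.
From mathcomp Require Import reals complex.
From mathcomp Require Import ring.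

Set Implicit Arguments.
Unset Strict Implicit.
Unset Printing Implicit Defensive.

Import GRing.Theory Num.Theory.
Local Open Scope ring_scope.

(** * Auxiliary integers and linear elimination *)

(** At most one integer i satisfies i + q = 0, so 1 or 3 works. L_{0,I} and L_{0,2I} then act with
    coefficients I + q and 2I + q that can be cancelled. *)
Lemma exists_shift_neq0 (F : numFieldType) (q : F) :
  exists I : int, [/\ I != 0, I%:~R + q != 0 & 2 * I%:~R + q != 0].
Proof.
have uniq_zero (i j : int) : i != j -> i%:~R + q = 0 -> j%:~R + q != 0.
  move=> ij qi; apply: contra ij => /eqP; rewrite -qi => /addIr /intr_inj ->.
  exact: eqxx.
have double (i : int) : 2 * i%:~R = (2 * i)%:~R :> F by rewrite intrM.
have [q1|q1] := eqVneq (1%:~R + q) 0; [|have [q2|q2] := eqVneq (2%:~R + q) 0].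
- by exists 3; rewrite double; split=> //; exact: uniq_zero q1.
- by exists 3; rewrite double; split=> //; exact: uniq_zero q2.
- by exists 1; rewrite double.
Qed.

(** Elimination by certificate: the multipliers are given explicitly, and [ring] or [field] checks
    the combination. *)
Lemma lincomb1 (F : fieldType) (k1 l1 r1 A B : F) :
  l1 = r1 -> A - B = k1 * (l1 - r1) -> A = B.
Proof. by move=> ->; rewrite subrr mulr0 => /subr0_eq. Qed.

Lemma lincomb2 (F : fieldType) (k1 k2 l1 r1 l2 r2 A B : F) :
  l1 = r1 -> l2 = r2 -> A - B = k1 * (l1 - r1) + k2 * (l2 - r2) -> A = B.
Proof. by move=> -> ->; rewrite !subrr !mulr0 addr0 => /subr0_eq. Qed.

(** * Homogeneous 1/2-derivations of degree (a, b) *)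

Section HalfDerivationCoefficients.
Context (F : numFieldType) (q : F) (a b : int) (f : int -> int -> F).

(** This is the coefficient of L_{m+n+a,i+j+b} in 2D[x,y] = [Dx,y] + [x,Dy] for x = L_{m,i}, y =
    L_{n,j} and D L_{m,i} = f(m,i) L_{m+a,i+b}. *)
Hypothesis half_der : forall m i n j : int,
  2 * (n%:~R * (i%:~R + q) - m%:~R * (j%:~R + q)) * f (m + n) (i + j) =
    f m i * (n%:~R * (i%:~R + b%:~R + q) - (m%:~R + a%:~R) * (j%:~R + q)) +
    f n j * ((n%:~R + a%:~R) * (i%:~R + q) - m%:~R * (j%:~R + b%:~R + q)).

Lemma half_der_coef_shift : a != 0 -> forall m i, f m i = 0.
Proof.
move=> a0; have aF : a%:~R != 0 :> F by rewrite intr_eq0.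
have [I [I0 x1 x2]] := exists_shift_neq0 q.
have IF : I%:~R != 0 :> F by rewrite intr_eq0.
have two0 : 2 != 0 :> F by rewrite pnatr_eq0.
have [c fc] : exists c, forall i, f 0 i = c * (i%:~R + q).
  exists (f 0 I / (I%:~R + q)) => i; apply: (mulfI aF).
  by apply: (lincomb1 (k1 := - (I%:~R + q)^-1) (half_der 0 I 0 i)); field.
have step n i j : i%:~R + q != 0 -> 2 * n%:~R * f n (i + j) =
    c * (n%:~R * (i%:~R + q + b%:~R) - a%:~R * (j%:~R + q))
      + (n%:~R + a%:~R) * f n j.
  move=> xi; apply: (mulfI xi); have := half_der 0 i n j.
  by rewrite fc add0r => E; apply: (lincomb1 (k1 := 1) E); ring.
have I2 j : I + (I + j) = 2 * I + j by ring.
have x2' : (2 * I)%:~R + q != 0 by rewrite intrM.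
(* At n = a the factors 2n and n + a agree. Reaching f a (3I) from f a I and from f a (2I), and both
   of these from f a 0, leaves 2a^2 I c = 0. *)
have c0 : c = 0.
  have E1 := step a I 0 x1; have E2 := step a (2 * I) I x2'.
  have E3 := step a (2 * I) 0 x2'; have E4 := step a I (2 * I) x1.
  rewrite !addr0 [I + _]addrC in E1 E3 E4.
  have k0 : 2 * (a%:~R * a%:~R) * I%:~R != 0 :> F by rewrite !mulf_neq0.
  apply: (mulfI k0).
  have {E2 E4}E24 := etrans (esym E2) E4.
  have E13 : 2 * a%:~R * (f a I - f a (2 * I)) = - c * a%:~R * I%:~R.
    by apply: (lincomb2 (k1 := 1) (k2 := -1) E1 E3); ring.
  by apply: (lincomb2 (k1 := a%:~R *+ 2) (k2 := a%:~R *- 2) E24 E13); ring.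
have {}step n i j : i%:~R + q != 0 ->
    2 * n%:~R * f n (i + j) = (n%:~R + a%:~R) * f n j.
  by move=> xi; rewrite step // c0 mul0r add0r.
have fa n j : n != a -> f n j = 0.
  move=> na; have [->|nNa] := eqVneq n (- a).
    have E := step (- a) I (j - I) x1.
    have k0 : 2 * (- a)%:~R != 0 :> F by rewrite mulf_neq0 // intr_eq0 oppr_eq0.
    by apply: (mulfI k0); rewrite -[j](subrKC I) E rmorphN addNr mul0r mulr0.
  (* One shift by 2I and two shifts by I give proportional values; comparing them yields (n+a)(n-a)
     f n j = 0. *)
  have k1 : n%:~R + a%:~R != 0 :> F.
    by rewrite -intrD intr_eq0 addr_eq0.
  have k2 : n%:~R - a%:~R != 0 :> F by rewrite -intrB intr_eq0 subr_eq0.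
  apply: (mulfI k1); apply: (mulfI k2).
  have E := step n (2 * I) j x2'; have E1 := step n I j x1.
  have E2 := step n I (I + j) x1; rewrite I2 in E2.
  have {E E2}E02 := etrans (esym E) E2.
  by apply: (lincomb2 (k1 := 2 * n%:~R) (k2 := n%:~R + a%:~R) E02 E1); ring.
(* For m = a, L_{a,i} is reached from [L_{2a,0}, L_{-a,i}] and from [L_{2a,1}, L_{-a,i-1}]. Both
   right-hand sides vanish, and the two bracket coefficients differ by a, so they are not both
   zero. *)
move=> m i; have [->|/fa->//] := eqVneq m a.
have fN j : f (- a) j = 0.
  by apply: fa; rewrite eq_sym -addr_eq0 -mulr2n mulrn_eq0.
have f2 j : f (2 * a) j = 0.
  by apply: fa; rewrite -subr_eq0 mulr_natl mulr2n addrK.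
have E0 := half_der (2 * a) 0 (- a) i.
have E1 := half_der (2 * a) 1 (- a) (i - 1).
rewrite !fN !f2 !(mul0r, addr0, add0r) in E0 E1.
rewrite subrKC in E1; have aa : 2 * a - a = a by ring.
rewrite aa in E0 E1.
have k0 : 2 * a%:~R != 0 :> F by rewrite mulf_neq0.
by apply: (mulfI k0); apply: (lincomb2 (k1 := -1) (k2 := 1) E0 E1); ring.
Qed.

Lemma half_der_coef_diag : a = 0 ->
  exists gamma, gamma * b%:~R = 0 /\ forall m i,
    f m i = gamma \/ [/\ m = 0, i%:~R + 2 * q = 0 & b%:~R = q].
Proof.
move=> a0; have [I [I0 x1 x2]] := exists_shift_neq0 q.
have two0 : 2 != 0 :> F by rewrite pnatr_eq0.
have step n i j : n != 0 -> 2 * (i%:~R + q) * f n (i + j) =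
    f 0 i * (i%:~R + q + b%:~R) + (i%:~R + q) * f n j.
  rewrite -(intr_eq0 F) => nF; apply: (mulfI nF).
  have := half_der 0 i n j.
  by rewrite a0 add0r => E; apply: (lincomb1 (k1 := 1) E); ring.
pose g i := f 0 i * (i%:~R + q + b%:~R) / (i%:~R + q).
have step' n i j : n != 0 -> i%:~R + q != 0 ->
    2 * f n (i + j) = g i + f n j.
  move=> n0 xi; apply: (mulfI xi); rewrite mulrDr mulrCA mulrA step // /g.
  by congr (_ + _); rewrite [RHS]mulrC divfK.
pose gamma := g I.
have I2 j : I + (I + j) = 2 * I + j by ring.
have x2' : (2 * I)%:~R + q != 0 by rewrite intrM.
(* Again f 1 (3I) is computed in two ways, and f 1 I, f 1 (2I) are computed from f 1 0. *)
have g2 : g (2 * I) = gamma.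
  have n1 : (1 : int) != 0 by [].
  have E1 := step' 1 (2 * I) I n1 x2'; have E2 := step' 1 I (2 * I) n1 x1.
  have E3 := step' 1 I 0 n1 x1; have E4 := step' 1 (2 * I) 0 n1 x2'.
  rewrite !addr0 [I + _]addrC -/gamma in E1 E2 E3 E4.
  have E12 := etrans (esym E1) E2.
  have E34 : 2 * (f 1 I - f 1 (2 * I)) = gamma - g (2 * I).
    by apply: (lincomb2 (k1 := 1) (k2 := -1) E3 E4); ring.
  by apply: (lincomb2 (k1 := 2) (k2 := -1) E12 E34); ring.
(* A shift by I or by 2I acts on values as x |-> (gamma + x)/2. One such step must equal two, so
   each value is its fixed point gamma. *)
have fgamma n j : n != 0 -> f n j = gamma.
  move=> n0; have E1 := step' n I j n0 x1; have E2 := step' n (2 * I) j n0 x2'.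
  have E3 := step' n I (I + j) n0 x1; rewrite I2 in E3.
  rewrite g2 -/gamma in E1 E2 E3.
  have E4 : 2 * gamma + 2 * f n j = 3 * gamma + f n j.
    by rewrite -mulrDr -E2 E3 mulrDr E1; ring.
  by apply: (lincomb1 (k1 := 1) E4); ring.
have gb : gamma * b%:~R = 0.
  have E := half_der 1 0 2 0; rewrite !fgamma // a0 in E.
  by apply: (lincomb1 (k1 := -1) E); ring.
exists gamma; split=> // m t.
have [->{m}|m0] := eqVneq m 0; last by left; exact: fgamma.
have [->|ft] := eqVneq (f 0 t) gamma; [by left | right].
rewrite -subr_eq0 in ft.
(* [L_{-1,0}, L_{1,t}] = (t + 2q) L_{0,t}, and f is already gamma on both arguments. *)
have tq : t%:~R + 2 * q = 0.
  have E := half_der (-1) 0 1 t.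
  rewrite addNr [0 + t]add0r (fgamma (-1)) // (fgamma 1) // a0 in E.
  apply: (mulIf ft); apply: (mulfI two0).
  by apply: (lincomb2 (k1 := 1) (k2 := 2) E gb); ring.
split=> //.
(* Acting by L_{0,t} on L_{1,0} with t = -2q relates f 0 t to gamma. If b = 0 this forces q = 0;
   otherwise gamma = 0 and f 0 t != 0, which forces b = q. *)
have E := step 1 t 0 isT; rewrite !(fgamma 1) // in E.
have tE : t%:~R = - 2 * q by rewrite mulNr; apply/eqP; rewrite -addr_eq0 tq.
have {}E : f 0 t * (b%:~R - q) = - gamma * q.
  by apply: (lincomb2 (k1 := -1) (k2 := gamma - f 0 t) E tE); ring.
have [b0|b0] := eqVneq (b%:~R : F) 0.
  apply: (mulIf ft); rewrite b0 mul0r; rewrite b0 in E.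
  by apply: (lincomb1 (k1 := 1) E); ring.
have gamma0 : gamma = 0 by apply: (mulIf b0); rewrite mul0r.
rewrite gamma0 subr0 in ft.
by apply: (mulfI ft); apply: (lincomb2 (k1 := 1) (k2 := - q) E gamma0); ring.
Qed.

End HalfDerivationCoefficients.

(** * Bilinear maps, rank-one products and diagonal maps on a free module *)

Section LinearExtension.
Context (F : fieldType).

Lemma linear_scale (U V : lmodType F) (f : U -> V) : linear f -> scalable f.
Proof. exact: GRing.scalable_linear. Qed.

Context (K : choiceType).
Implicit Types f g : {malg F[K]} -> {malg F[K]} -> {malg F[K]}.

Lemma bilinear_eq f g : is_bilinear f -> is_bilinear g ->
  (forall u v, f << u >> << v >> = g << u >> << v >>) ->
  forall x y, f x y = g x y.
Proof.
move=> [fl fr] [gl gr] fg x y; apply/eqP; rewrite -subr_eq0; apply/eqP.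
move: y; apply: malg_linear_eq0 => [a s t|v].
  by rewrite fl gl scalerBr opprD addrACA.
move: x; apply: malg_linear_eq0 => [a s t|u]; last by rewrite fg subrr.
by rewrite fr gr scalerBr opprD addrACA.
Qed.

Lemma linear_bilinear f h : is_bilinear f -> linear h ->
  is_bilinear (fun x y => h (f x y)).
Proof.
move=> [fl fr] lh; split=> x a y z; first by rewrite fl lh.
by rewrite fr lh.
Qed.

Lemma bilinear_comp f h : is_bilinear f -> linear h ->
  is_bilinear (fun x y => f (h x) (h y)).
Proof.
by move=> [fl fr] lh; split=> x a y z; rewrite lh ?fl ?fr.
Qed.

(** The normal shape of all products below: for integral q only the scalar c remains free, and c = 0
    serves as the zero product. *)
Definition coef_prod (c : F) (e z : K) (x y : {malg F[K]}) : {malg F[K]} :=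
  (c * (x@_e * y@_e)) *: << z >>.

Lemma coef_prod_bilinear c e z : is_bilinear (coef_prod c e z).
Proof.
split=> x a y t; rewrite /coef_prod mcoeffD mcoeffZ scalerA -scalerDl;
  by congr (_ *: _); ring.
Qed.

Lemma coef_prodC c e z : commutative (coef_prod c e z).
Proof. by move=> x y; rewrite /coef_prod (mulrC x@_e). Qed.

(** Both bracketings are symmetric in the three coefficients at e. This includes e = z, which occurs
    for q = 0. *)
Lemma coef_prodA c e z : associative (coef_prod c e z).
Proof.
move=> x y t; rewrite /coef_prod !mcoeffZ; congr (_ *: _).
by move: x@_e y@_e t@_e << z >>@_e => {x y t} x y t s; ring.
Qed.

Definition diag_map (d : K -> F) (x : {malg F[K]}) : {malg F[K]} :=
  [malg u in msupp x => d u * x@_u].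

Lemma mcoeff_diag_map d x u : (diag_map d x)@_u = d u * x@_u.
Proof.
by rewrite mcoeffE; case: ifPn => // /mcoeff_outdom ->; rewrite mulr0.
Qed.

Lemma diag_map_linear d : linear (diag_map d).
Proof.
move=> a x y; apply/malgP => u.
by rewrite !(mcoeff_diag_map, mcoeffD, mcoeffZ); ring.
Qed.

Lemma diag_mapU d u : diag_map d << u >> = d u *: << u >>.
Proof.
apply/malgP => v; rewrite mcoeff_diag_map mcoeffZ mcoeffU.
by have [->|] := eqVneq u v; rewrite ?mulr0n ?mulr0.
Qed.

Lemma diag_map_bij d : (forall u, d u != 0) -> bijective (diag_map d).
Proof.
move=> d0; exists (diag_map (fun u => (d u)^-1)) => x; apply/malgP => u;
  by rewrite !mcoeff_diag_map ?mulKf ?mulVKf.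
Qed.

End LinearExtension.

(** * Coefficients of a transposed Poisson product in the basis *)

Section BlockProduct.
Context (F : numFieldType) (q : F).
Local Notation K := (int * int)%type.
Implicit Types (u v w : K) (x y : {malg F[K]}).
Local Notation B := (block_bracket q).

Lemma block_bracketUU u v :
  B << u >> << v >> = block_coef q u v *: << (u.1 + v.1, u.2 + v.2) >>.
Proof. exact: bilinear_extUU. Qed.

Lemma block_coefN u v : block_coef q u v = - block_coef q v u.
Proof. by rewrite /block_coef opprB. Qed.

Lemma block_bracketN x y : B x y = - B y x.
Proof.
have [bl br] := block_bracket_bilinear q.
move: x y; apply: bilinear_eq; first exact: block_bracket_bilinear.
  by split=> x a y z; rewrite ?bl ?br opprD scalerN.
move=> u v; rewrite !block_bracketUU block_coefN scaleNr.
by rewrite [u.1 + _]addrC [u.2 + _]addrC.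
Qed.

(** Bracketing with L_v translates indices by v, so only index w - v contributes at w. *)
Lemma mcoeff_block_bracketU x v w : (B x << v >>)@_w =
  x@_(w.1 - v.1, w.2 - v.2) * block_coef q (w.1 - v.1, w.2 - v.2) v.
Proof.
pose h x := B x << v >>; rewrite -/(h x).
have hl : linear h := (block_bracket_bilinear q).2 << v >>.
have hU u : h << u >> = block_coef q u v *: << (u.1 + v.1, u.2 + v.2) >>.
  exact: block_bracketUU.
(* Forgetting the body of h keeps unification from unfolding the bracket. *)
set w' := (_ - _, _); move: h hl hU => h hl hU.
move cE: (block_coef q w' v) => c.
(* The scalar identity is carried on the line of [<< w >>] so that [malg_linear_eq0] applies. *)
have E : ((h x)@_w - x@_w' * c) *: << w >> = 0 :> {malg F[K]}.
  move: x; apply: malg_linear_eq0 => [a s t|u].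
    rewrite hl !mcoeffD !mcoeffZ scalerA -scalerDl.
    by rewrite mulrBr mulrDl mulrA opprD addrACA.
  rewrite hU mcoeffZ !mcoeffU.
  have -> : ((u.1 + v.1, u.2 + v.2) == w) = (u == w').
    rewrite /w'; case: (u) (w) => [m i] [n j] /=.
    by rewrite !xpair_eqE /= -!subr_eq !opprK.
  have [->|_] := eqVneq u w'; last by rewrite mulr0 mul0r subrr scale0r.
  by rewrite cE mulr1 mul1r subrr scale0r.
have := congr1 (fun z : {malg F[K]} => z@_w) E.
by rewrite mcoeffZ mcoeffUU mcoeff0 mulr1 => /subr0_eq.
Qed.

Lemma mcoeff_Ublock_bracket x v w : (B << v >> x)@_w =
  x@_(w.1 - v.1, w.2 - v.2) * block_coef q v (w.1 - v.1, w.2 - v.2).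
Proof.
by rewrite block_bracketN mcoeffN mcoeff_block_bracketU block_coefN mulrN opprK.
Qed.

Context (p : {malg F[K]} -> {malg F[K]} -> {malg F[K]}).
Hypothesis p_bilinear : is_bilinear p.
Hypothesis pC : commutative p.
Hypothesis p_leibniz : forall x y z,
  2%:R *: p z (B x y) = B (p z x) y + B x (p z y).

Lemma tp_half_der (z : {malg F[K]}) (a b m i n j : int)
    (f := fun m i => (p z << (m, i) >>)@_(m + a, i + b)) :
  2 * (n%:~R * (i%:~R + q) - m%:~R * (j%:~R + q)) * f (m + n) (i + j) =
    f m i * (n%:~R * (i%:~R + b%:~R + q) - (m%:~R + a%:~R) * (j%:~R + q)) +
    f n j * ((n%:~R + a%:~R) * (i%:~R + q) - m%:~R * (j%:~R + b%:~R + q)).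
Proof.
have := p_leibniz << (m, i) >> << (n, j) >> z.
have pZ := linear_scale (p_bilinear.1 z).
rewrite block_bracketUU pZ.
move=> /(congr1 (fun x : {malg F[K]} => x@_(m + n + a, i + j + b))).
rewrite mcoeffD 2!mcoeffZ -/(f (m + n) (i + j)) mulrA => ->.
congr (_ + _).
  rewrite mcoeff_block_bracketU /= /block_coef /=.
  have -> : m + n + a - n = m + a by ring.
  have -> : i + j + b - j = i + b by ring.
  by rewrite !intrD.
rewrite mcoeff_Ublock_bracket /= /block_coef /=.
have -> : m + n + a - m = n + a by ring.
have -> : i + j + b - i = j + b by ring.
by rewrite !intrD.
Qed.

Lemma tp_mcoeff_off u v w : w.1 != v.1 -> (p << u >> << v >>)@_w = 0.
Proof.
case: v w => [m i] [n j] /= nm.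
have nm0 : n - m != 0 by rewrite subr_eq0.
have := half_der_coef_shift (@tp_half_der << u >> (n - m) (j - i)) nm0 m i.
by rewrite !subrKC.
Qed.

(** The coefficient belongs to the component of degree w - v of multiplication by L_u. In the
    exceptional case, v = (0,-2q) shifted by (0,q) gives w = (0,-q). *)
Lemma tp_mcoeff u v w : (p << u >> << v >>)@_w = 0
  \/ [/\ v.1 = 0, v.2%:~R + 2 * q = 0, w.1 = 0 & w.2%:~R + q = 0].
Proof.
have [|] := eqVneq w.1 v.1; last by move/tp_mcoeff_off; left.
case: u v w => [m i] [n j] [n' j'] /= ->.
have [gamma [gb fE]] :=
  half_der_coef_diag (@tp_half_der << (m, i) >> 0 (j' - j)) erefl.
have := fE n j; rewrite addr0 subrKC => -[->|[n0 jq bq]]; last first.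
  right; split=> //; apply: (lincomb2 (k1 := 1) (k2 := 1) bq jq).
  by rewrite intrB; ring.
left; have [jj|jj] := eqVneq (j' - j) 0; last first.
  by apply: (mulIf (x := (j' - j)%:~R)); rewrite ?intr_eq0 // gb mul0r.
(* gamma is also the coefficient of L_{r,0} in L_{r,0}.L_{m,i}, where the shift
   has nonzero first component, hence it vanishes. *)
have [r [r0 rm]] : exists r : int, r != 0 /\ r != m.
  by have [->|m1] := eqVneq m 1; [exists 2 | exists 1; rewrite (eq_sym _ m)].
have := @tp_mcoeff_off (r, 0) (m, i) (r, 0) rm.
rewrite pC; have := fE r 0; rewrite addr0 jj => -[-> //|[r1 _ _]].
by rewrite r1 eqxx in r0.
Qed.

(** By commutativity the exceptional condition on v holds for u as well, so both have index (0,-2q).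
    The conditions are equations in F, to cover integral and non-integral q alike. *)
Lemma tp_mcoeff_eq0 u v w :
  ~ [/\ u = v, v.1 = 0, v.2%:~R + 2 * q = 0, w.1 = 0 & w.2%:~R + q = 0] ->
  (p << u >> << v >>)@_w = 0.
Proof.
move=> N; have [//|[v1 v2 w1 w2]] := tp_mcoeff u v w.
have := tp_mcoeff v u w; rewrite pC => -[//|[u1 u2 _ _]].
case: N; split=> //; case: u v v1 v2 u1 u2 => [m i] [n j] /= -> vq -> uq.
by congr (_, _); apply: (@intr_inj F); apply: (addIr (2 * q)); rewrite uq.
Qed.

End BlockProduct.

(** * The case of integral q: the standard product and diagonal automorphisms *)

Section IntegralParameter.
Context (F : numFieldType) (q : F) (k : int).
Hypothesis qE : q = k%:~R.
Local Notation K := (int * int)%type.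
Local Notation B := (block_bracket q).
Let e : K := (0, - 2 * k).
Let z : K := (0, - k).

Lemma tp_coef_prod (p : {malg F[K]} -> {malg F[K]} -> {malg F[K]}) :
  is_bilinear p -> commutative p ->
  (forall x y t, 2%:R *: p t (B x y) = B (p t x) y + B x (p t y)) ->
  forall x y, p x y = coef_prod (p << e >> << e >>)@_z e z x y.
Proof.
move=> pl pC pL; apply: bilinear_eq => //; first exact: coef_prod_bilinear.
move=> u v; apply/malgP => w; rewrite mcoeffZ !mcoeffU.
have [/and3P[/eqP-> /eqP-> /eqP->]|N] := boolP [&& u == e, v == e & w == z].
  by rewrite !eqxx !mulr1.
have {}N : ~ [/\ u = e, v = e & w = z].
  by case=> ue ve we; rewrite ue ve we !eqxx in N.
have -> : (p << u >> << v >>)@_w = 0.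
  apply: (tp_mcoeff_eq0 pl pC pL); case=> uv v1 v2 w1 w2; apply: N.
  have ve : v = e.
    rewrite [v]surjective_pairing v1; congr (_, _).
    by apply: (@intr_inj F); apply: (lincomb1 (k1 := 1) v2); rewrite qE; ring.
  split=> //; first by rewrite uv.
  rewrite [w]surjective_pairing w1; congr (_, _).
  by apply: (@intr_inj F); apply: (lincomb1 (k1 := 1) w2); rewrite qE; ring.
have [ue|_] := eqVneq u e; last by rewrite mul0r mulr0 mul0r.
have [ve|_] := eqVneq v e; last by rewrite !mulr0 mul0r.
by rewrite eq_sym; have [we|_] := eqVneq w z; [case: N; split | rewrite mulr0].
Qed.

(** If u + v = e, the bracket coefficient of L_u and L_v is v.1 (u.2 + v.2 + 2q) = 0. *)
Lemma block_bracket_e x y : (B x y)@_e = 0.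
Proof.
(* The bracket followed by projection to the line of L_e is compared with the zero product on basis
   vectors. *)
have BE : coef_prod 0 e e x y = diag_map (fun u => (u == e)%:R) (B x y).
  move: x y; apply: bilinear_eq; first exact: coef_prod_bilinear.
    by apply: linear_bilinear;
      [exact: block_bracket_bilinear | exact: diag_map_linear].
  move=> u v.
  have DZ := linear_scale (diag_map_linear (fun u => (u == e)%:R : F)).
  rewrite block_bracketUU DZ diag_mapU scalerA /coef_prod mul0r scale0r.
  have [uve|_] := eqVneq (_, _) e; last by rewrite mulr0 scale0r.
  case: uve => /eqP; rewrite addr_eq0 => /eqP u1 /eqP.
  rewrite -subr_eq0 => /eqP u2.
  rewrite [X in X *: _](_ : _ = 0) ?scale0r // mulr1 /block_coef u1 qE.
  apply: (lincomb1 (k1 := v.1%:~R) (congr1 (fun n : int => n%:~R : F) u2)).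
  by rewrite rmorph0; ring.
have := congr1 (fun x : {malg F[K]} => x@_e) BE.
by rewrite mcoeff_diag_map eqxx mul1r /coef_prod mul0r scale0r mcoeff0 => <-.
Qed.

Lemma block_bracket_z y : B << z >> y = 0.
Proof.
move: y; apply: malg_linear_eq0; first exact: (block_bracket_bilinear q).1.
move=> u; rewrite block_bracketUU /block_coef /= rmorphN /= qE.
by rewrite addNr mulr0 mul0r subrr scale0r.
Qed.

(** Multiplicativity of d is asked only where the bracket is nonzero, which permits rescaling
    L_{0,0} alone when q = 0. *)
Lemma diag_block d : (forall u v, block_coef q u v != 0 ->
    d (u.1 + v.1, u.2 + v.2) = d u * d v) ->
  forall x y, diag_map d (B x y) = B (diag_map d x) (diag_map d y).
Proof.
move=> dM; apply: bilinear_eq.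
- by apply: linear_bilinear;
    [exact: block_bracket_bilinear | exact: diag_map_linear].
- by apply: bilinear_comp;
    [exact: block_bracket_bilinear | exact: diag_map_linear].
move=> u v.
have BZr := linear_scale ((block_bracket_bilinear q).2 (d v *: << v >>)).
have BZl := linear_scale ((block_bracket_bilinear q).1 << u >>).
have DZ := linear_scale (diag_map_linear d).
rewrite !diag_mapU BZr BZl block_bracketUU DZ diag_mapU !scalerA.
have [->|c0] := eqVneq (block_coef q u v) 0.
  by rewrite mul0r mulr0 !scale0r.
by congr (_ *: _); rewrite dM // mulrC.
Qed.

Definition standard_mul : block q -> block q -> block q := coef_prod 1 e z.

Lemma standard_mul_bilinear : is_bilinear standard_mul.
Proof. exact: coef_prod_bilinear. Qed.

Lemma standard_mulC : commutative standard_mul.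
Proof. exact: coef_prodC. Qed.

Lemma standard_mulA : associative standard_mul.
Proof. exact: coef_prodA. Qed.

(** Both sides vanish: brackets have no L_e coefficient, and products lie on the central line of
    L_z. *)
Lemma standard_mul_leibniz x y t :
  2%:R *: standard_mul t (bracket x y)
    = bracket (standard_mul t x) y + bracket x (standard_mul t y).
Proof.
have Bz c (s : {malg F[K]}) : B (c *: << z >>) s = 0.
  have BZ := linear_scale ((block_bracket_bilinear q).2 s).
  by rewrite BZ block_bracket_z scaler0.
rewrite /standard_mul /coef_prod /bracket /= block_bracket_e !mulr0.
rewrite scale0r scaler0.
by rewrite (block_bracketN q x) !Bz oppr0 addr0.
Qed.

Definition standard_tp : transposedPoisson (block q) :=
  TransposedPoisson standard_mul_bilinear standard_mulC standard_mulA
    standard_mul_leibniz.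

(** The condition [c * d z = d e ^+ 2] is compatibility with the products at the pair (L_e, L_e). *)
Lemma diag_tp_isomorphic (P : transposedPoisson (block q)) d (c : F) :
  (forall x y : {malg F[K]}, P x y = coef_prod c e z x y) ->
  (forall u, d u != 0) ->
  (forall u v, block_coef q u v != 0 -> d (u.1 + v.1, u.2 + v.2) = d u * d v) ->
  c * d z = d e ^+ 2 ->
  tp_isomorphic P standard_tp.
Proof.
move=> PE d0 dM cd; exists (diag_map d).
  by split; [exact: diag_map_linear | exact: diag_map_bij | exact: diag_block].
move=> x y; rewrite PE /= /standard_mul /coef_prod.
have DZ := linear_scale (diag_map_linear d).
rewrite DZ diag_mapU scalerA !mcoeff_diag_map; congr (_ *: _).
by apply: (lincomb1 (k1 := x@_e * y@_e) cd); ring.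
Qed.
End IntegralParameter.

(** * Normalization of the scalar and the classification *)

Lemma exists_expz_root (F : numClosedFieldType) (n : int) (c : F) :
  n != 0 -> c != 0 -> exists2 t : F, t != 0 & t ^ n = c.
Proof.
have pos (m : nat) (a : F) : a != 0 -> exists2 t : F, t != 0 & t ^+ m.+1 = a.
  move=> a0; exists (m.+1.-root a); last by rewrite rootCK.
  by rewrite rootC_eq0.
case: n => [[//|n] _ c0|n _ c0]; first exact: pos.
have [t t0 tn] := pos n c^-1 (invr_neq0 c0).
by exists t => //; rewrite NegzE -exprnN tn invrK.
Qed.

Lemma nontrivial_tp_isomorphic (F : numClosedFieldType) (q : F) (k : int)
    (qE : q = k%:~R) (P : transposedPoisson (block q)) :
  ~ tp_trivial P -> tp_isomorphic P (standard_tp qE).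
Proof.
have PE := tp_coef_prod qE (tp_bilinear P) (@tp_mulC _ _ P) (@tp_leibniz _ _ P).
set c := (_)@_ _ in PE => ntP.
have c0 : c != 0.
  apply/eqP => c0; apply: ntP => x y.
  by rewrite PE c0 /coef_prod mul0r scale0r.
have [k0|k0] := eqVneq k 0.
  (* Here e = z = 0, so the condition on d reads c d(0) = d(0)^2. Nonzero brackets never involve
     L_{0,0}, as argument or as value. *)
  pose d (u : int * int) := if u == 0 then c else 1.
  apply: (@diag_tp_isomorphic _ _ _ qE P d c PE).
  - by move=> u; rewrite /d; case: ifP; rewrite ?oner_eq0.
  - move=> u v; rewrite /block_coef qE k0 !addr0 -!intrM -intrB.
    rewrite intr_eq0 /d => uv0.
    have [u0|_] := eqVneq u 0; first by rewrite u0 !(mulr0, mul0r) eqxx in uv0.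
    have [v0|_] := eqVneq v 0; first by rewrite v0 !(mulr0, mul0r) eqxx in uv0.
    case: eqP => [[/eqP + /eqP]|_]; last by rewrite mulr1.
    rewrite !addr_eq0 => /eqP u1 /eqP u2.
    by rewrite u1 u2 mulrN mulNr mulrC subrr eqxx in uv0.
  - by rewrite /d k0 mulr0 oppr0 eqxx expr2.
(* With d u = t^(u.2) the condition is c t^(-k) = t^(-4k), hence the exponent -3k. *)
have k3 : - 3 * k != 0 by rewrite mulf_neq0.
have [t t0 tc] := exists_expz_root k3 c0.
pose d (u : int * int) := t ^ u.2.
apply: (@diag_tp_isomorphic _ _ _ qE P d c PE).
- by move=> u; rewrite expfz_neq0.
- by move=> u v _; rewrite /d expfzDr.
- by rewrite /d /= -tc expr2 -!expfzDr //; congr (t ^ _); ring.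
Qed.

Lemma tp_trivial_nonint (F : numFieldType) (q : F) :
  (forall k : int, q <> k%:~R) ->
  forall P : transposedPoisson (block q), tp_trivial P.
Proof.
move=> qN P x y; transitivity (coef_prod 0 (0 : int * int) 0 x y : {malg F[_]}).
  move: x y; apply: bilinear_eq; first exact: (tp_bilinear P).
    exact: coef_prod_bilinear.
  move=> u v; apply/malgP => w; rewrite /coef_prod mul0r scale0r mcoeff0.
  apply: (tp_mcoeff_eq0 (tp_bilinear P) (@tp_mulC _ _ P) (@tp_leibniz _ _ P)).
  (* A nonzero coefficient at w would make q the integer -w.2. *)
  case=> _ _ _ _ /eqP; rewrite addrC addr_eq0 -rmorphN => /eqP; exact: qN.
by rewrite /coef_prod mul0r scale0r.
Qed.

Theorem theorem2p14 (R : realType) (q : R[i]) :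
  ((forall k : int, q <> k%:~R) ->
     forall P : transposedPoisson (block q), tp_trivial P)
  /\
  (forall k : int, q = k%:~R ->
     exists P : transposedPoisson (block q),
       [/\ P (blockL q 0 (- 2 * k)) (blockL q 0 (- 2 * k)) = blockL q 0 (- k),
           forall m i n j : int,
             (m, i, n, j) <> (0, - 2 * k, 0, - 2 * k) ->
             P (blockL q m i) (blockL q n j) = 0,
           ~ tp_trivial P
         & forall P' : transposedPoisson (block q),
             ~ tp_trivial P' -> tp_isomorphic P' P]).
Proof.
split=> [|k qE]; first exact: tp_trivial_nonint.
pose P := standard_tp qE.
have Pe : P (blockL q 0 (- 2 * k)) (blockL q 0 (- 2 * k)) = blockL q 0 (- k).
  by rewrite /P /= /standard_mul /coef_prod !mcoeffUU !mulr1 scale1r.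
exists P; split=> //.
- move=> m i n j ne; rewrite /P /= /standard_mul /coef_prod !mcoeffU mul1r.
  case: eqP => [[m0 i0]|_]; last by rewrite mulr0n mul0r scale0r.
  case: eqP => [[n0 j0]|_]; last by rewrite mulr0n mulr0 scale0r.
  by case: ne; rewrite m0 i0 n0 j0.
- move=> triv; have Z0 := etrans (esym Pe) (triv _ _).
  have /eqP := congr1 (fun x : {malg _[_]} => x@_(0, - k)) Z0.
  by rewrite mcoeffUU mcoeff0 oner_eq0.
- exact: nontrivial_tp_isomorphic.
Qed.
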